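(* Let $q$ be a prime power, $b\ge 1$ an integer, and $k$ a positive integer with $k\geq b$. Let $\gamma$ be a primitive element of $\mathbb{F}_{q^k}$. Let $$\mathcal{C}=\left\{\mathbf{c}_{g,y}=\left(\mathrm{Tr}_{q^k/q}\left(g\,\gamma^{i}\right)+y\right)_{i=0}^{q^k-2}: g\in\mathbb{F}_{q^k}\text{ and }y\in\mathbb{F}_q\right\}\subseteq\mathbb{F}_q^{q^k-1}.$$ Then $\mathcal{C}$ has parameters $\left(q^k-1,\;k+1,\;q^k-q^{k-b}-1\right)^b_q$ and is distance-optimal with respect to the $b$-symbol Griesmer bound.
   Context: $\mathrm{Tr}_{q^k/q}(x)=x+x^q+\cdots+x^{q^{k-1}}$ is the trace from $\mathbb{F}_{q^k}$ to $\mathbb{F}_q$; a primitive element is a generator of the multiplicative group $\mathbb{F}_{q^k}^*$. For $\mathbf{a},\mathbf{c}\in\mathbb{F}_q^n$, the $b$-symbol distance is $d_b(\mathbf{a},\mathbf{c})=|\{0\le i\le n-1:(a_i,\ldots,a_{i+b-1})\neq(c_i,\ldots,c_{i+b-1})\}|$, with subscripts taken modulo $n$. An $(n,k',d_b)^b_q$ linear code is a $k'$-dimensional $\mathbb{F}_q$-subspace of $\mathbb{F}_q^n$ whose minimum $b$-symbol distance between distinct codewords equals $d_b$. The $b$-symbol Griesmer bound, satisfied by every $(n,k',d_b)^b_q$ linear code, is $$\frac{(q^b-1)n}{q-1}\ge\sum_{i=0}^{k'-1}\left\lceil\frac{q^{b-1}d_b}{q^i}\right\rceil .$$ An $(n,k',d_b)^b_q$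 linear code is distance-optimal if there is no $(n,k',d_b+1)^b_q$ linear code; it is distance-optimal with respect to the $b$-symbol Griesmer bound if this nonexistence follows from the bound, i.e. if the inequality fails when $d_b$ is replaced by $d_b+1$.
   Formalization: The case q = 2, k = 1 (so b = 1) is excluded: there the code has length 1 and equals F_2, so it has dimension 1 and not k+1 = 2, and the claim is false as stated. *)

(* Defs.v *)
From HB Require Import structures.
From mathcomp Require Import all_boot all_order all_algebra all_field.

Set Implicit Arguments.
Unset Strict Implicit.
Unset Printing Implicit Defensive.

Import Order.TTheory GRing.Theory Num.Theory.
Local Open Scope ring_scope.

Section BSymbolCodes.

Variables (F : finFieldType) (n : nat).
Implicit Types (b k d : nat) (a c : 'rV[F]_n) (C : {set 'rV[F]_n}).

(* Subscripts are cyclic: [iter j (@ordS n) i] is [(i + j) mod n]. *)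
Definition window b a (i : 'I_n) : 'rV[F]_b :=
  \row_(j < b) a ord0 (iter j (@ordS n) i).

Lemma val_iter_ordS (i : 'I_n) (j : nat) :
  iter j (@ordS n) i = ((i + j) %% n)%N :> nat.
Proof.
elim: j => [|j IHj] /=; first by rewrite addn0 modn_small.
by rewrite IHj -addn1 modnDml addn1 addnS.
Qed.

Definition bsymbol_dist b a c : nat :=
  #|[set i : 'I_n | window b a i != window b c i]|.

Definition min_bsymbol_dist_eq b C d : Prop :=
  (exists a c, [/\ a \in C, c \in C, a != c & bsymbol_dist b a c = d]) /\
  (forall a c, a \in C -> c \in C -> a != c -> (d <= bsymbol_dist b a c)%N).

Definition bsymbol_code b k d C : Prop :=
  (exists2 V : {vspace 'rV[F]_n}, C =i V & \dim V = k) /\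
  min_bsymbol_dist_eq b C d.

Definition distance_optimal b k d C : Prop :=
  bsymbol_code b k d C /\ forall D : {set 'rV[F]_n}, ~ bsymbol_code b k d.+1 D.

End BSymbolCodes.

Definition bsymbol_griesmer_bound (q b n k d : nat) : bool :=
  (\sum_(i < k) (Num.ceil (q%:R ^+ b.-1 * d%:R / q%:R ^+ i : rat))%:~R
    <= (q%:R ^+ b - 1) * n%:R / (q%:R - 1) :> rat).

(* Both the nonexistence of a code with distance d + 1 and the fact that the
   bound witnesses it are required. *)
Definition griesmer_distance_optimal (F : finFieldType) (n b k d : nat)
    (C : {set 'rV[F]_n}) : Prop :=
  distance_optimal b k d C /\ ~~ bsymbol_griesmer_bound #|F| b n k d.+1.

Section TraceCode.

Variables (F : finFieldType) (L : fieldExtType F).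
Implicit Types (x g gamma : L) (y : F).

Definition primitive_element gamma : Prop :=
  gamma != 0 /\ forall x, x != 0 -> exists i : nat, x = gamma ^+ i.

Definition ext_trace x : L := \sum_(i < \dim {:L}) x ^+ (#|F| ^ i).

(* The trace as an element of the base field; the default value of [odflt] is
   never used, by [trE]. *)
Definition tr x : F := odflt 0 [pick y : F | in_alg L y == ext_trace x].

Lemma trE x : in_alg L (tr x) = ext_trace x.
Proof.
rewrite /tr; case: pickP => [y /eqP //|noy].
have [p p_pr pchF] := finPcharP F.
have pchL : p \in [pchar L] by rewrite (fmorph_pchar (in_alg L)).
have [m cardF] : exists m, #|F| = (p ^ m)%N.
  exists (logn p #|F|); apply: (card_pprimeChar pchF).
have cardL : #|finvect_type L| = (#|F| ^ \dim {:L})%N.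
  rewrite -(@card_vspace F (finvect_type L) (Vector.class (finvect_type L))).
  by symmetry; apply: card_vspacef.
have frob_sum (I : finType) (f : I -> L) :
    (\sum_i f i) ^+ #|F| = \sum_i f i ^+ #|F|.
  rewrite cardF; elim: m {cardF} f => [|m IHm] f.
    by rewrite expn0 expr1; apply: eq_bigr => i _; rewrite expr1.
  rewrite expnS mulnC exprM IHm -(pFrobenius_autE pchL) rmorph_sum.
  by apply: eq_bigr => i _; rewrite /= pFrobenius_autE -exprM.
have frob_tr : ext_trace x ^+ #|F| = ext_trace x.
  have dL : (0 < \dim {:L})%N by rewrite adim_gt0.
  have xL : x ^+ (#|F| ^ \dim {:L}) = x.
    by rewrite -cardL; apply: (@expf_card (finvect_type L)).
  rewrite /ext_trace frob_sum; case: (\dim {:L}) dL xL => // k _ xL.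
  rewrite big_ord_recr [RHS]big_ord_recl /= -exprM -expnSr xL expn0 expr1 addrC.
  by congr (_ + _); apply: eq_bigr => i _; rewrite -exprM -expnSr.
have: root (map_poly (in_alg L) ('X^#|F| - 'X)) (ext_trace x).
  rewrite rmorphB /= map_polyXn map_polyX rootE !hornerE.
  by rewrite ?hornerXn frob_tr subrr.
rewrite finField_genPoly rmorph_prod /= rootE horner_prod => /prodf_eq0[y _].
rewrite rmorphB /= map_polyX map_polyC !hornerE subr_eq0 => /eqP Ey.
by have:= noy y; rewrite -Ey eqxx.
Qed.

Definition trace_codeword (n : nat) gamma g y : 'rV[F]_n :=
  \row_(i < n) (tr (g * gamma ^+ i) + y).

(* [finvect_type L] is [L] itself, with its finite type structure. *)
Definition trace_code (n : nat) gamma : {set 'rV[F]_n} :=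
  [set trace_codeword n gamma g y | g : finvect_type L, y : F].

End TraceCode.

(* Main.v *)
Require Import Defs.
From HB Require Import structures.
From mathcomp Require Import all_boot all_order all_algebra all_field.
From mathcomp Require Import zify.

(* Since [gamma] generates [L] over [F], the powers [gamma ^+ j], [j < k], span
   [L]; as the trace form is nondegenerate, [x |-> (tr (x * gamma ^+ j))_(j < k)]
   is a bijection onto [F ^ k], so prescribing the first [b] coordinates leaves
   [q ^ (k - b)] values of [x].  For [g != 0] the points [g * gamma ^+ i] run
   once through the nonzero elements of [L], so the weight of the codeword of
   [(g, y)] is [q ^ k - q ^ (k - b)], minus 1 when [y != 0].  A code with minimum
   distance [d + 1] contradicts a Plotkin-type averaging of all its weights. *)

Set Implicit Arguments.
Unset Strict Implicit.
Unset Printing Implicit Defensive.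

Import Order.TTheory GRing.Theory Num.Theory.
Local Open Scope ring_scope.

(** * Nondegeneracy of the trace and the orbit of a primitive element *)

Section Trace.

Variables (F : finFieldType) (L : fieldExtType F).
Implicit Types (x y z gamma : L).

Let q := #|F|.
Let k : nat := \dim {:L}.
Let fL : finType := finvect_type L.

Lemma card_finvect_dim : #|fL| = (q ^ k)%N.
Proof.
rewrite -(@card_vspace F (finvect_type L) (Vector.class (finvect_type L))).
by symmetry; apply: card_vspacef.
Qed.

(** Since [q] is a power of the characteristic, each [x ^+ (q ^ i)] is additive in [x]; scalars come
    out because [a ^+ q = a] in [F]. *)
Lemma ext_trace_linear (a : F) x y :
  ext_trace (a *: x + y) = a *: ext_trace x + ext_trace y.
Proof.
have [p p_pr pchF] := finPcharP F.
have pchL : p \in [pchar L] by rewrite (fmorph_pchar (in_alg L)).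
have pnatq i : [pchar L].-nat (q ^ i)%N.
  rewrite pnatX (eq_pnat _ (pcharf_eq pchL)) /q.
  by rewrite (@card_pprimeChar _ F pchF : #|F| = _) pnatX pnat_id.
rewrite /ext_trace scaler_sumr -big_split /=; apply: eq_bigr => i _.
rewrite exprDn_pchar // exprZn; congr (_ *: _ + _).
by elim: (i : nat) => [|m IHm] //; rewrite expnS exprM expf_card.
Qed.

Lemma tr_scale1 x : tr x *: 1 = ext_trace x.
Proof. exact: trE. Qed.

Lemma tr_linear : linear (@tr F L : L -> F^o).
Proof.
move=> a x y; apply: (fmorph_inj (in_alg L)).
change (tr (a *: x + y) *: 1 = (a * tr x + tr y) *: 1 :> L).
by rewrite scalerDl -scalerA !tr_scale1 ext_trace_linear.
Qed.

HB.instance Definition _ := GRing.isLinear.Build F L F^o _ (@tr F L) tr_linear.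

Lemma tr0 : tr (0 : L) = 0.
Proof. exact: linear0. Qed.

(* The trace is a polynomial function of degree [q ^ k.-1 < q ^ k]. *)
Lemma tr_not_zero : exists x, tr x != 0.
Proof.
pose P : {poly L} := \sum_(i < k) 'X^(q ^ i).
have q_gt1 : (1 < q)%N := finNzRing_gt1 F.
have k_gt0 : (0 < k)%N := adim_gt0 _.
have P0 : P != 0.
  (* The coefficient of ['X] in [P] is 1, as [q ^ i = 1] only for [i = 0]. *)
  apply/eqP => /(congr1 (fun R : {poly L} => R`_1)); rewrite coef0 coef_sum.
  rewrite (bigD1 (Ordinal k_gt0)) //= coefXn expn0 eqxx big1 ?addr0.
    by move/eqP; rewrite oner_eq0.
  move=> i ine; rewrite coefXn -{1}(expn0 q) eqn_exp2l // eq_sym.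
  by rewrite -[(i : nat) == 0%N]/(i == Ordinal k_gt0) (negPf ine).
have sP : (size P <= (q ^ k.-1).+1)%N.
  apply: (leq_trans (size_sum _ _ _)); apply/bigmax_leqP => i _.
  by rewrite size_polyXn ltnS leq_exp2l // -ltnS prednK.
have [x trx|tr0] := pickP (fun x : fL => tr (x : L) != 0); first by exists x.
have := @max_poly_roots L P (enum fL) P0 ^~ (enum_uniq fL).
have -> : size (enum fL : seq L) = (q ^ k)%N by rewrite -card_finvect_dim cardE.
move=> lt_sP.
have : (q ^ k < size P)%N.
  apply: lt_sP; apply/allP => x _; rewrite rootE horner_sum.
  have /eqP tx0 := negbFE (tr0 x).
  under eq_bigr do rewrite hornerXn.
  by rewrite -/(ext_trace (x : L)) -tr_scale1 tx0 scale0r.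
move=> /leq_trans/(_ sP); rewrite ltnS leqNgt ltn_exp2l //.
by rewrite ltn_predL k_gt0.
Qed.

Lemma tr_nondegenerate x : (forall y, tr (x * y) = 0) -> x = 0.
Proof.
move=> trx0; apply/eqP; apply: contraT => x_neq0.
have [y] := tr_not_zero.
by rewrite -[y](mulVKf x_neq0) trx0 eqxx.
Qed.

Variable gamma : L.
Hypothesis gamma_prim : primitive_element gamma.

Lemma primitive_Fadjoin : <<1; gamma>>%VS = fullv.
Proof.
apply/vspaceP => x; rewrite memvf; have [->|/gamma_prim.2[i ->]] := eqVneq x 0.
  by rewrite mem0v.
by rewrite rpredX // memv_adjoin.
Qed.

Definition trace_row m x : 'rV[F]_m := \row_(j < m) tr (x * gamma ^+ j).

Lemma trace_row0 m : trace_row m 0 = 0.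
Proof. by apply/rowP => j; rewrite !mxE mul0r tr0. Qed.

(** The difference [x1 - x2] is trace-orthogonal to [gamma ^+ j] for [j < k], hence to every
    polynomial in [gamma] of degree below [k], that is, to all of [L]. *)
Lemma trace_row_inj : injective (trace_row k).
Proof.
move=> x1 x2 /rowP eq_x; apply/eqP; rewrite -subr_eq0; apply/eqP.
apply: tr_nondegenerate => y.
have y_adj : y \in <<1; gamma>>%VS by rewrite primitive_Fadjoin memvf.
rewrite -(Fadjoin_poly_eq y_adj); set P := Fadjoin_poly _ _ _.
have sP : (size P <= k)%N.
  apply: leq_trans (size_Fadjoin_poly _ _ _) _.
  by rewrite adjoin_degreeE primitive_Fadjoin dimv1 divn1.
have /polyOverP P1 : P \is a polyOver 1%VS by apply: Fadjoin_polyOver.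
rewrite (horner_coef_wide _ sP) mulr_sumr linear_sum big1 // => i _.
have /vlineP[a ->] := P1 i.
rewrite -scalerAl mul1r -scalerAr linearZ /= mulrBl linearB /=.
by have := eq_x i; rewrite !mxE => ->; rewrite subrr scaler0.
Qed.

(** These are the first [b] coordinates of the bijection [trace_row k]; the remaining [k - b] can be
    chosen freely. *)
Lemma card_trace_row_fiber b (v : 'rV[F]_b) : (b <= k)%N ->
  #|[set x : fL | trace_row b x == v]| = (q ^ (k - b))%N.
Proof.
move=> /subnKC; set m := (k - b)%N => def_k.
pose f : fL -> 'rV[F]_(b + m) := trace_row (b + m).
have inj_f : injective f.
  by rewrite /f def_k; apply: trace_row_inj.
have f_onto w : exists x, f x = w.
  have /codomP[x ->] : w \in codom f.
    apply: inj_card_onto => //.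
    by rewrite card_finvect_dim card_mx mul1n def_k.
  by exists x.
rewrite -(card_imset _ inj_f).
have -> : f @: [set x : fL | trace_row b x == v]
          = row_mx v @: [set: 'rV_m].
  have lsub_tr x : lsubmx (f x) = trace_row b x.
    by apply/rowP => j; rewrite !mxE.
  apply/setP => w; apply/imsetP/imsetP => [[x]|[u _ ->]].
    rewrite inE => /eqP <- ->; exists (rsubmx (f x)) => //.
    by rewrite -lsub_tr hsubmxK.
  have [x def_x] := f_onto (row_mx v u).
  by exists x; rewrite ?def_x // inE -lsub_tr def_x row_mxKl.
rewrite card_imset; last by move=> u1 u2 /eq_row_mx[].
by rewrite cardsT card_mx mul1n.
Qed.

Variable n : nat.
Hypothesis def_n : n = (q ^ k - 1)%N.

(** Reconciles the cyclic subscripts of a window with exponents of [gamma]. *)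
Lemma primitive_expr_mod i : gamma ^+ (i %% n) = gamma ^+ i.
Proof.
suff gamma1 : gamma ^+ n = 1.
  by rewrite [in RHS](divn_eq i n) exprD mulnC exprM gamma1 expr1n mul1r.
(* Multiplied by [gamma], the claim becomes [gamma ^+ (q ^ k) = gamma]. *)
apply: (mulfI gamma_prim.1); rewrite mulr1 -exprS def_n subn1 prednK.
  by rewrite -card_finvect_dim; apply: (@expf_card (finvect_type L)).
by rewrite expn_gt0 (ltnW (finNzRing_gt1 F)).
Qed.

(** Surjectivity comes from primitivity applied to [g^-1 * x]; injectivity then follows by counting,
    since there are [n] indices and [n] nonzero elements. *)
Lemma primitive_orbit (g : L) : g != 0 ->
  injective (fun i : 'I_n => g * gamma ^+ i : fL) /\
  forall x : L, x != 0 -> exists i : 'I_n, x = g * gamma ^+ i.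
Proof.
move=> g_neq0.
have n_gt0 : (0 < n)%N.
  rewrite def_n subn_gt0 -{1}(expn0 q) ltn_exp2l ?finNzRing_gt1 //.
  exact: adim_gt0.
pose f (i : 'I_n) : fL := g * gamma ^+ i.
have onto (x : L) : x != 0 -> exists i : 'I_n, x = g * gamma ^+ i.
  move=> x_neq0; have [|i def_i] := gamma_prim.2 (g^-1 * x).
    by rewrite mulf_neq0 ?invr_neq0.
  exists (Ordinal (ltn_pmod i n_gt0)).
  by rewrite /= primitive_expr_mod -def_i mulVKf.
split=> //.
have imf : f @: [set: 'I_n] = [set~ (0 : finvect_type L)].
  apply/setP => x; rewrite !inE; apply/imsetP/idP => [[i _ ->]|/onto[i def_x]].
    by rewrite mulf_neq0 // expf_neq0 // gamma_prim.1.
  by exists i.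
have /imset_injP inj_f : #|f @: [set: 'I_n]| == #|[set: 'I_n]|.
  by rewrite imf cardsC1 cardsT card_ord card_finvect_dim def_n subn1.
by move=> i j; apply: inj_f; rewrite inE.
Qed.

End Trace.

Arguments trace_row {F L} gamma m x.

(** * Linearity of windows and the Plotkin-type inequality *)

Section Windows.

Variables (F : finFieldType) (n b : nat).
Implicit Types (a c : 'rV[F]_n) (i : 'I_n).

Let q := #|F|.

(** The position comes first, so that each [window_at i] can carry a linear structure. *)
Definition window_at i a : 'rV[F]_b := window b a i.

Lemma window_at_linear i : linear (window_at i).
Proof. by move=> x a c; apply/rowP => j; rewrite !mxE. Qed.

HB.instance Definition _ i :=
  GRing.isLinear.Build F 'rV[F]_n 'rV[F]_b _ (window_at i) (window_at_linear i).

Lemma window0 i : window b (0 : 'rV[F]_n) i = 0.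
Proof. exact: (linear0 (window_at i)). Qed.

Lemma bsymbol_distB a c : bsymbol_dist b a c = bsymbol_dist b (a - c) 0.
Proof.
apply: eq_card => i; rewrite !inE window0 -subr_eq0.
by have -> : window b (a - c) i = _ := linearB (window_at i) a c.
Qed.

Lemma bsymbol_dist0E a :
  bsymbol_dist b a 0 = (n - #|[set i | window b a i == 0%R]|)%N.
Proof.
rewrite -[X in (X - _)%N]card_ord -(cardsC [set i | window b a i == 0]) addKn.
by apply: eq_card => i; rewrite !inE window0.
Qed.

(* A window of length [b] vanishes on a subspace of codimension at most [b];
   average the weights of all codewords. *)
Lemma bsymbol_plotkin (V : {vspace 'rV[F]_n}) d :
    (forall v, v \in V -> v != 0 -> (d <= bsymbol_dist b v 0)%N) ->
  ((q ^ \dim V - 1) * d <= n * (q ^ \dim V - q ^ (\dim V - b)))%N.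
Proof.
move=> minV; set K : nat := \dim V.
have cardV (U : {vspace 'rV[F]_n}) : #|[set v in U]| = (q ^ \dim U)%N.
  by rewrite cardsE card_vspace.
have cardV1 : #|[set v in V] :\ 0| = (q ^ K - 1)%N.
  by rewrite -cardV (cardsD1 0 [set v in V]) inE mem0v add1n subn1.
rewrite -cardV1 -sum_nat_const.
apply: (@leq_trans (\sum_(v in [set v in V]) bsymbol_dist b v 0)).
  rewrite [leqRHS](big_setD1 0) ?inE ?mem0v //= (leq_trans _ (leq_addl _ _)) //.
  by apply: leq_sum => v; rewrite !inE => /andP[v0 Vv]; apply: minV.
(* Double counting: for each position [i], count the words of [V] whose window at [i] is nonzero. *)
under eq_bigr do rewrite /bsymbol_dist -sum1_card big_mkcond /=.
rewrite exchange_big /= -[X in (X * _)%N]card_ord -sum_nat_const.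
apply: leq_sum => i _; rewrite -big_mkcondr sum1_card.
pose f := linfun (window_at i).
have kerV : \dim (V :&: lker f) + \dim (f @: V) = K := limg_ker_dim f V.
have dim_im : (\dim (f @: V) <= b)%N.
  by rewrite (leq_trans (dimvS (subvf _))) // dimvf dim_matrix [leqLHS]mul1n.
have le_ker : (K - b <= \dim (V :&: lker f))%N.
  by rewrite leq_subLR -kerV [leqRHS]addnC leq_add2l.
apply: (@leq_trans (q ^ K - q ^ \dim (V :&: lker f))); last first.
  by rewrite leq_sub2l // leq_exp2l // finNzRing_gt1.
rewrite -!cardV -(cardsID [set v in lker f] [set v in V]).
rewrite (_ : [set v in V] :&: [set v in lker f] = [set v in V :&: lker f]%VS).
  rewrite addKn subset_leq_card //; apply/subsetP => v.
  case/andP; rewrite !inE window0 => Vv w_neq0; rewrite Vv andbT memv_ker.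
  by rewrite lfunE.
by apply/setP => v; rewrite !inE memv_cap.
Qed.

End Windows.

(** * Weights, dimension and minimum distance of the trace code *)

Section TraceCodewords.

Variables (F : finFieldType) (L : fieldExtType F) (gamma : L) (n b : nat).
Implicit Types (g x : L) (y : F).

Let q := #|F|.
Let k : nat := \dim {:L}.
Let fL : finType := finvect_type L.

Hypothesis gamma_prim : primitive_element gamma.
Hypothesis def_n : n = (q ^ k - 1)%N.
Hypothesis b_gt0 : (0 < b)%N.
Hypothesis le_bk : (b <= k)%N.

Lemma window_trace_codeword g y (i : 'I_n) :
  window b (trace_codeword n gamma g y) i
  = trace_row gamma b (g * gamma ^+ i) + const_mx y.
Proof.
apply/rowP => j; rewrite !mxE val_iter_ordS (primitive_expr_mod gamma_prim) //.
by rewrite exprD mulrA.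
Qed.

(** Zero windows correspond to nonzero points [x] of the fibre [Z] over [const_mx (- y)]. This fibre
    has [q ^ (k - b)] elements and contains 0 exactly when [y = 0]. *)
Lemma weight_trace_codeword g y : g != 0 ->
  bsymbol_dist b (trace_codeword n gamma g y) 0
  = (q ^ k - q ^ (k - b) - (y != 0%R))%N.
Proof.
move=> g_neq0; have [inj_orb onto_orb] := primitive_orbit gamma_prim def_n g_neq0.
pose Z : {set fL} := [set x : fL | trace_row gamma b x == const_mx (- y)].
pose f (i : 'I_n) : fL := g * gamma ^+ i.
have imZ : f @: [set i | window b (trace_codeword n gamma g y) i == 0]
    = Z :\ (0 : finvect_type L).
  apply/setP => x; rewrite !inE; apply/imsetP/andP => [[i]|[x_neq0]].
    rewrite inE window_trace_codeword addr_eq0 => /eqP wi0 ->; split.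
      by rewrite mulf_neq0 // expf_neq0 // gamma_prim.1.
    by rewrite wi0; apply/eqP/rowP => j; rewrite !mxE.
  have [i ->] := onto_orb x x_neq0 => /eqP wi0.
  exists i => //; rewrite inE window_trace_codeword wi0.
  by apply/eqP/rowP => j; rewrite !mxE addNr.
have cardZ : #|Z| = (q ^ (k - b))%N by apply: card_trace_row_fiber.
rewrite bsymbol_dist0E -(@card_imset _ _ f _ inj_orb) imZ.
have := cardsD1 (0 : finvect_type L) Z; rewrite cardZ def_n.
rewrite inE; have -> : trace_row gamma b (0 : finvect_type L) = 0.
  exact: trace_row0.
have -> : (0 == const_mx (- y) :> 'rV_b) = (y == 0).
  apply/eqP/eqP => [/rowP/(_ (Ordinal b_gt0))|->].
    by rewrite !mxE => /esym/eqP; rewrite oppr_eq0 => /eqP.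
  by apply/rowP => j; rewrite !mxE oppr0.
by case: eqP => _ ->; rewrite -!subnDA ?addn0 //= add0n addnC.
Qed.

Lemma trace_codeword0 y : trace_codeword n gamma 0 y = const_mx y.
Proof. by apply/rowP => i; rewrite !mxE mul0r tr0 add0r. Qed.

Lemma weight_const_mx y : y != 0 ->
  bsymbol_dist b (const_mx y : 'rV[F]_n) 0 = n.
Proof.
move=> y_neq0; rewrite bsymbol_dist0E; apply/eqP; rewrite -[n in _ == n]subn0.
apply/eqP; congr (_ - _)%N; apply/eqP; rewrite cards_eq0; apply/eqP/setP => i.
rewrite !inE; apply/negP => /eqP/rowP/(_ (Ordinal b_gt0)).
by rewrite !mxE => /eqP; rewrite (negPf y_neq0).
Qed.

Let d := (q ^ k - q ^ (k - b) - 1)%N.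

Lemma weight_trace_codeword_ge g y : (g, y) != (0, 0) ->
  (d <= bsymbol_dist b (trace_codeword n gamma g y) 0)%N.
Proof.
have [->|g_neq0 _] := eqVneq g 0; last first.
  by rewrite weight_trace_codeword // leq_sub2l // leq_b1.
have [->|y_neq0 _] := eqVneq y 0; first by rewrite eqxx.
rewrite trace_codeword0 weight_const_mx // def_n /d subnAC.
exact: leq_subr.
Qed.

(** Presents the code as the image of one linear map on a space of dimension [k + 1]. *)
Definition trace_encode (u : L * F^o) : 'rV[F]_n :=
  trace_codeword n gamma u.1 u.2.

Lemma trace_encode_linear : linear trace_encode.
Proof.
move=> a [g1 y1] [g2 y2]; apply/rowP => i; rewrite !mxE /=.
by rewrite mulrDl -scalerAl tr_linear mulrDr; apply: addrACA.
Qed.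

HB.instance Definition _ :=
  GRing.isLinear.Build F (L * F^o)%type 'rV[F]_n _ trace_encode
    trace_encode_linear.

Lemma trace_code_space : (0 < d)%N ->
  exists2 V : {vspace 'rV[F]_n}, trace_code n gamma =i V & \dim V = (k + 1)%N.
Proof.
move=> d_gt0; pose f := linfun trace_encode.
exists (limg f) => [v|].
  apply/imset2P/memv_imgP => [[g y _ _ ->]|[[g y] _ ->]].
    by exists (g : L, y : F^o); rewrite ?memvf ?lfunE.
  by exists g y; rewrite ?inE // lfunE.
rewrite limg_dim_eq.
  by rewrite dimvf /k dimvf.
(* The kernel is trivial: a nonzero pair has weight at least [d > 0]. *)
rewrite capfv; apply/eqP; rewrite -subv0; apply/subvP => [[g y]].
rewrite memv_ker lfunE memv0 => /eqP fu0; apply: contraT => gy_neq0.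
have := weight_trace_codeword_ge gy_neq0.
rewrite -[trace_codeword _ _ _ _]/(trace_encode (g, y)) fu0.
rewrite leqNgt (leq_trans _ d_gt0) // ltnS leqn0 cards_eq0.
by apply/eqP/setP => i; rewrite !inE eqxx.
Qed.

Lemma trace_code_bsymbol_code :
  (0 < d)%N -> bsymbol_code b (k + 1) d (trace_code n gamma).
Proof.
move=> d_gt0; split; first exact: trace_code_space.
split.
  (* With [g] and [y] both nonzero the weight formula loses its 1, so the minimum is attained. *)
  exists (trace_codeword n gamma 1 1), 0; split.
  - by apply/imset2P; exists (1 : L) 1.
  - apply/imset2P; exists (0 : L) 0 => //.
    by rewrite trace_codeword0; apply/rowP => i; rewrite !mxE.
  - apply: contraTneq d_gt0 => c0.
    have := weight_trace_codeword 1 (oner_neq0 L).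
    rewrite c0 oner_eq0 -/d => <-; rewrite -leqNgt leqn0 cards_eq0.
    by apply/eqP/setP => i; rewrite !inE eqxx.
  - by rewrite weight_trace_codeword ?oner_neq0 // oner_eq0.
move=> a c; case/imset2P => g1 y1 _ _ -> /imset2P[g2 y2 _ _ ->] neq_c.
rewrite bsymbol_distB.
have eB : trace_codeword n gamma g1 y1 - trace_codeword n gamma g2 y2
          = trace_codeword n gamma ((g1 : L) - g2) (y1 - y2).
  exact: esym (linearB trace_encode (g1 : L, y1 : F^o) (g2 : L, y2 : F^o)).
rewrite eB; apply: weight_trace_codeword_ge; apply: contraNneq neq_c => -[].
by move=> /subr0_eq -> /subr0_eq ->.
Qed.

End TraceCodewords.

(** * Optimality of the distance *)

Lemma no_better_bsymbol_code (F : finFieldType) (b k : nat)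
    (D : {set 'rV[F]_(#|F| ^ k - 1)}) :
  (0 < b)%N -> (b <= k)%N ->
  ~ bsymbol_code b (k + 1) (#|F| ^ k - #|F| ^ (k - b)) D.
Proof.
set q := #|F|; move=> b_gt0 le_bk [[V defD dimV] [_ minD]].
have q_gt1 : (1 < q)%N := finNzRing_gt1 F.
have q_gt0 := ltnW q_gt1.
have k_gt0 := leq_trans b_gt0 le_bk.
set d := (_ - q ^ (k - b))%N in minD.
have d_gt0 : (0 < d)%N by rewrite subn_gt0 ltn_exp2l // ltn_subrL b_gt0.
have /bsymbol_plotkin : forall v, v \in V -> v != 0 -> (d <= bsymbol_dist b v 0)%N.
  by move=> v Vv v_neq0; apply: minD; rewrite ?defD ?mem0v.
rewrite dimV -/q.
(* Cancelling [d] in the Plotkin inequality leaves [q ^ (k + 1) - 1 <= q ^ (k + 1) - q], false for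
   [q > 1]. *)
have -> : (q ^ (k + 1) - q ^ (k + 1 - b) = q * d)%N.
  by rewrite addn1 subSn // !expnS mulnBr.
rewrite mulnA leq_pmul2r // mulnBl mul1n addn1 expnS [(q ^ k * q)%N]mulnC.
rewrite leqNgt ltn_sub2l //.
by rewrite -expnS -{1}(expn0 q) ltn_exp2l.
Qed.

(* Without the ceilings the terms [i < k] already add up to the right-hand
   side, and the term [i = k] is positive. *)
Lemma griesmer_bound_fails (q b k : nat) :
  (1 < q)%N -> (0 < b)%N -> (b <= k)%N ->
  ~~ bsymbol_griesmer_bound q b (q ^ k - 1) (k + 1) (q ^ k - q ^ (k - b)).
Proof.
move=> q_gt1 b_gt0 le_bk; rewrite /bsymbol_griesmer_bound -ltNge.
set x := _ ^+ b.-1 * _; pose Q : rat := q%:R.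
have Q_gt1 : 1 < Q by rewrite ltr1n.
have Q_gt0 : 0 < Q := lt_trans ltr01 Q_gt1.
have Q_neq0 : Q != 0 by rewrite gt_eqF.
have Qb_gt1 : 1 < Q ^+ b by rewrite exprn_egt1 // -lt0n.
have k_gt0 := leq_trans b_gt0 le_bk.
have def_x : x = (Q ^+ b - 1) * Q ^+ k.-1.
  rewrite /x natrB ?leq_exp2l ?leq_subr // !natrX mulrBl mulrBr mul1r -/Q.
  by rewrite -!exprD; congr (Q ^+ _ - Q ^+ _); lia.
apply: (@lt_le_trans _ _ (\sum_(i < k + 1) x / Q ^+ i)); last first.
  by apply: ler_sum => i _; apply: ceil_ge.
rewrite addn1 big_ord_recr /=.
have geomQ : (q ^ k - 1)%:R / (Q - 1) = \sum_(i < k) Q ^+ i.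
  have q_k_gt0 : (0 < q ^ k)%N by rewrite expn_gt0 ltnW.
  rewrite (natrB _ q_k_gt0) natrX -/Q subrX1 mulrAC mulfV ?mul1r //.
  by rewrite subr_eq0 gt_eqF.
(* Reversing the geometric sum matches its terms with [x / Q ^+ i], as
   [x = (Q ^+ b - 1) * Q ^+ k.-1]. *)
rewrite -mulrA geomQ (reindex_inj rev_ord_inj) mulr_sumr.
have -> : \sum_(i < k) (Q ^+ b - 1) * Q ^+ rev_ord i = \sum_(i < k) x / Q ^+ i.
  apply: eq_bigr => i _; rewrite def_x -mulrA; congr (_ * _).
  apply: (canRL (mulfK _)); first by rewrite expf_neq0.
  by rewrite -exprD /=; congr (_ ^+ _); have := ltn_ord i; lia.
by rewrite ltrDl def_x divr_gt0 ?mulr_gt0 ?subr_gt0 ?exprn_gt0.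
Qed.

(** Here [d + 1 = q ^ (k - b) * (q ^ b - 1)], which is 1 only if [q = 2] and [k = b = 1]. In that
    case the length is 1, too short for dimension 2. *)
Lemma trace_code_dist_gt0 (q b k : nat) :
    (1 < q)%N -> (0 < b)%N -> (b <= k)%N -> ~ (q = 2%N /\ k = 1%N) ->
  (0 < q ^ k - q ^ (k - b) - 1)%N.
Proof.
move=> q_gt1 b_gt0 le_bk nondeg.
have q_gt0 := ltnW q_gt1.
suff : (1 < q ^ (k - b) * (q ^ b - 1))%N.
  by rewrite mulnBr muln1 -expnD subnK // subn_gt0.
have [m0|m_gt0] := posnP (k - b).
  rewrite m0 expn0 mul1n; have [b_gt1|b_le1] := ltnP 1 b.
    have : (q ^ 2 <= q ^ b)%N by rewrite leq_exp2l.
    by nia.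
  have b1 : b = 1%N by lia.
  have q_neq2 : q <> 2%N by move=> q2; apply: nondeg; lia.
  by rewrite b1 expn1; lia.
have : (q ^ 1 <= q ^ (k - b))%N by rewrite leq_exp2l.
have : (q ^ 1 <= q ^ b)%N by rewrite leq_exp2l.
by nia.
Qed.

Theorem theorem6 (q b k : nat) (F : finFieldType) (L : fieldExtType F)
    (gamma : L) (cardF : #|F| = q) (dimL : \dim {:L} = k)
    (b_gt0 : (0 < b)%N) (k_gt0 : (0 < k)%N) (le_bk : (b <= k)%N)
    (nondegenerate : ~ (q = 2%N /\ k = 1%N))
    (gamma_prim : primitive_element gamma) :
  let n := (q ^ k - 1)%N in
  let d := (q ^ k - q ^ (k - b) - 1)%N in
  bsymbol_code b (k + 1) d (trace_code n gamma) /\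
  griesmer_distance_optimal b (k + 1) d (trace_code n gamma).
Proof.
move=> n d; have q_gt1 : (1 < q)%N by rewrite -cardF finNzRing_gt1.
have d_gt0 : (0 < d)%N by apply: trace_code_dist_gt0.
(* Subtraction is truncated, so positivity of [d] is used to restore the 1. *)
have d1 : d.+1 = (q ^ k - q ^ (k - b))%N.
  by rewrite -[RHS]prednK -?subn1 // -(subn_gt0 0) subn0 (leq_trans d_gt0) ?leq_subr.
have codeC : bsymbol_code b (k + 1) d (trace_code n gamma).
  by rewrite /d /n; subst q k; apply: trace_code_bsymbol_code.
rewrite /griesmer_distance_optimal /distance_optimal d1 cardF.
split; [exact: codeC | split; first split; first exact: codeC].
  by rewrite /n; subst q; move=> D; apply: no_better_bsymbol_code.
exact: griesmer_bound_fails.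
Qed.
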